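(* Let $N, n$ be nonnegative integers. Let $G$ be a planar graph with boundary embedded in a disc, having $N$ internal vertices $v_1, v_2, \dots, v_N$ and $n$ boundary vertices $v_{N+1}, v_{N+2}, \dots, v_{N+n}$ in that circular order. Then there is an $(N+n)\times(N+n)$ skew symmetric matrix $X$ with $X_{ij} = -X_{ji} = \pm 1$ if there is an edge from $v_i$ to $v_j$, and $X_{ij}=0$ otherwise, having the following property: for any subset $I$ of $\partial G$, let $X_I$ be the submatrix of $X$ using the first $N$ rows and first $N$ columns, and additionally those rows and columns indexed by $I$. Then $\mathbb{D}(G,I) = \mathrm{Pf}(X_I)$.
   Context: Graphs are finite and simple, and not assumed bipartite. A graph with boundary is a finite graph $G$ with a specified subset $\partial G$ of its vertices, equipped with a circular ordering. The vertices in $\partial G$ are the boundary vertices; the other vertices are the internal vertices. A graph with boundary is embedded in a disc if $G$ is embedded (without edge crossings) in a closed planar disc $D$ such that the vertices of $\partial G$ lie on the boundary circle $\partial D$, in their specified circular order. A perfect matching of a graph with boundary $G$ is a collection $M$ of edges of $G$ such that each internal vertex is contained in exactly one edge of $M$ and each boundary vertex is contained in at most one edge of $M$. For such $M$, $\partial M$ denotes the set of boundary vertices contained in edges of $M$. For $I \subseteq \partial G$, $\mathbb{D}(G,I)$ denotes the number of perfect matchings $M$ of $G$ with $\partial M = I$. $\mathrm{Pf}$ denotes the Pfaffian; the Pfaffian of an odd by odd skew symmetric matrix is taken to be zero (and that of the empty matrix is $1$). Rows and columns of submatrices are kept in the order they have in the full matrix; the boundary vertex $v_{N+j}$ corresponds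 to row and column $N+j$ of $X$. *)

(* Defs.v *)
From HB Require Import structures.
From mathcomp Require Import all_boot all_order all_algebra all_fingroup.

Set Implicit Arguments.
Unset Strict Implicit.
Unset Printing Implicit Defensive.

Import Order.TTheory GRing.Theory Num.Theory.

Local Open Scope ring_scope.

(* [boundary_seq] lists each boundary vertex once, in circular order; only its
   class up to rotation is meaningful. *)
Record bgraph := BGraph {
  vertex :> finType;
  adj : rel vertex;
  adj_sym : symmetric adj;
  adj_irrefl : irreflexive adj;
  boundary_seq : seq vertex;
  boundary_seq_uniq : uniq boundary_seq
}.

Section Matchings.
Local Open Scope set_scope.
Variable G : bgraph.

Definition boundary : {set G} := [set x in boundary_seq G].

Definition edges : {set {set G}} :=
  [set [set p.1; p.2] | p : G * G & adj p.1 p.2].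

Definition cover_degree (M : {set {set G}}) (x : G) : nat :=
  #|[set e in M | x \in e]|.

Definition perfect_matching (M : {set {set G}}) : bool :=
  [&& M \subset edges,
      [forall (x | x \notin boundary), cover_degree M x == 1%N]
    & [forall (x | x \in boundary), (cover_degree M x <= 1)%N]].

Definition matching_boundary (M : {set {set G}}) : {set G} :=
  boundary :&: cover M.

Definition num_matchings (I : {set G}) : nat :=
  #|[set M : {set {set G}} | perfect_matching M & matching_boundary M == I]|.

End Matchings.

Section Pfaffian.
Variables (R : comNzRingType) (m : nat).

(* [s] is the word s_0 s_1 ... s_{m-1} of the pairing
   {s_0,s_1}, {s_2,s_3}, ..., normalised by s_{2k} < s_{2k+1} and
   s_0 < s_2 < s_4 < ..., so that each pairing of the m indices is listed
   exactly once when m is even. *)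
Definition pairing_perm (s : 'S_m) : bool :=
  [forall i : 'I_m, forall j : 'I_m,
     (~~ odd i && (j == i.+1 :> nat)) ==> (s i < s j)%N] &&
  [forall i : 'I_m, forall j : 'I_m,
     [&& ~~ odd i, ~~ odd j & (i < j)%N] ==> (s i < s j)%N].

Definition Pf (A : 'M[R]_m) : R :=
  if odd m then 0 else
  \sum_(s : 'S_m | pairing_perm s)
    (-1) ^+ s *
    \prod_(p : 'I_m * 'I_m | ~~ odd p.1 && (p.2 == p.1.+1 :> nat))
      A (s p.1) (s p.2).

End Pfaffian.

(* [enum_val] enumerates a set of ordinals in increasing order, so rows and
   columns keep their relative order. *)
Definition principal_submx (R : Type) (m : nat) (A : 'M[R]_m) (J : {set 'I_m}) :
    'M[R]_#|J| :=
  mxsub (@enum_val _ (mem J)) (@enum_val _ (mem J)) A.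

From mathcomp Require Import mathcomp_extra boolp classical_sets reals.
From mathcomp Require Import topology normedtype trigo.
Import numFieldNormedType.Exports.

Section Embedding.
Local Open Scope classical_set_scope.
Variable R : realType.

Definition closed_disc (c : R * R) (r : R) : set (R * R) :=
  [set p | (p.1 - c.1) ^+ 2 + (p.2 - c.2) ^+ 2 <= r ^+ 2].

Definition circle_point (c : R * R) (r t : R) : R * R :=
  (c.1 + r * cos t, c.2 + r * sin t).

Definition simple_arc (a b : R * R) (C : set (R * R)) : Prop :=
  exists g : R -> R * R,
    [/\ {within `[0, 1], continuous g},
        {in `[0, 1] &, injective g},
        g 0 = a, g 1 = b
      & C = g @` `[0, 1]].

(* The boundary vertices sit on the circle at angles which are monotone along
   [boundary_seq] and stay within less than one full turn. Both senses of rotation are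
   allowed, since a circular order does not prescribe one. *)
Record disc_embedding (G : bgraph) := DiscEmbedding {
  center : R * R;
  radius : R;
  radius_gt0 : 0 < radius;
  pos : G -> R * R;
  curve : {set G} -> set (R * R);
  angle : G -> R;
  pos_inj : injective pos;
  pos_disc : forall x, closed_disc center radius (pos x);
  curve_arc : forall x y, adj x y ->
    simple_arc (pos x) (pos y) (curve [set x; y]%SET);
  curve_disc : forall e, e \in edges G ->
    curve e `<=` closed_disc center radius;
  curve_vertex : forall e x, e \in edges G -> curve e (pos x) -> x \in e;
  curve_cross : forall e f p, e \in edges G -> f \in edges G -> e != f ->
    curve e p -> curve f p -> exists2 x, x \in (e :&: f)%SET & p = pos x;
  pos_boundary : forall x, x \in boundary G ->
    pos x = circle_point center radius (angle x);
  angle_turn : forall x y, x \in boundary G -> y \in boundary G ->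
    angle y < angle x + 2 * pi;
  angle_sorted :
    sorted (fun x y => angle x < angle y) (boundary_seq G) \/
    sorted (fun x y => angle x > angle y) (boundary_seq G)
}.

End Embedding.

(* Main.v *)
Require Import Defs.
From mathcomp Require Import all_boot all_order all_algebra all_fingroup.
From mathcomp Require Import ring lra zify.
From mathcomp Require complex.

(** Why the theorem holds.

    A term of [Pf (X_I)] is given by a pairing of the indices, and its sign is
    the parity of the inversions of the word of that pairing.  An inversion
    involves two different pairs, so this parity is the sum, over unordered
    couples of edges [e], [f] of the matching, of the number of [a] in [e] and
    [b] in [f] with [b < a].  It suffices to show that, for disjoint edges,
    this number is congruent modulo 2 to

      sum over b in f of kappa(e, b)  +  sum over a in e of kappa(f, a)

    for some parities [kappa(e, w)] that vanish when [w] is a boundary vertex.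
    Indeed, summing over all couples in a matching with boundary [I], each
    internal vertex is covered exactly once, so the sign of the matching is the
    product over its edges [e] of [(-1)^tau(e)], where [tau(e)] is the sum of
    [kappa(e, w)] over all internal vertices [w] outside [e].  This depends on
    neither the matching nor [I].  Putting [X_ij = (-1)^tau(e)] for [i < j]
    makes every matching count for 1 (lemmas [odd_pairing_perm] and
    [Pf_counts_matchings]).

    The parities come from the embedding, without the Jordan curve theorem.
    Let [g] and [h] parametrise the curves of [e], from [x] to [y], and of [f],
    from [x'] to [y'].  As the curves are disjoint, [g(s) - h(t)] is a nonzero
    complex number on the whole unit square, hence it has a continuous square
    root there, and following a square root once around the boundary of the
    square does not change its sign.  The four sides of the square are [e] seen
    from [x'] and from [y'], and the opposites of [f] seen from [x] and from
    [y]; passing from a vector to its opposite multiplies a root by [i] or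
    [-i].  For every ordered pair of vertices [a], [b] choose a root of
    [a - b], in such a way that the root for [(a, b)] is [i] or [-i] times the
    root for [(b, a)] according to the order of [a] and [b].  Let
    [kappa(e, w)] tell whether the choices at the two ends of [e] disagree when
    followed along [e] seen from [w].  Then the sign around the square is
    exactly the required congruence ([exists_winding_parity]).

    A boundary vertex [w] sees the rest of the disc within an open half-plane,
    where the root has a canonical branch; choosing that branch makes
    [kappa(e, w)] vanish.  For two boundary vertices both choices are thus
    forced, and they differ by the prescribed factor because the angles are
    monotone within one turn ([flip_circle_chord]).  Reversing the sense of
    rotation exchanges the four comparisons between two edges with their
    negations, which preserves the parity.

    Continuous roots are replaced by finite samples of the curves, so fine that
    the differences over each cell of the grid lie in a common half-plane;
    compactness provides them ([finely_separated_near]). *)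

Set Implicit Arguments.
Unset Strict Implicit.
Unset Printing Implicit Defensive.
Import Order.TTheory GRing.Theory Num.Theory.
Local Open Scope ring_scope.

(** * Signs of pairings *)

Lemma big_addb_set2 (T : finType) (x y : T) (F : T -> bool) : x != y ->
  \big[addb/false]_(a in [set x; y]) F a = F x (+) F y.
Proof. by move=> xy; rewrite big_setU1 ?inE // big_set1. Qed.

Lemma prod_sign (I : finType) (P : pred I) (F : I -> bool) :
  \prod_(i | P i) (-1) ^+ F i = (-1) ^+ (\big[addb/false]_(i | P i) F i) :> int.
Proof.
have sign0 : (-1) ^+ false = 1 :> int by [].
by rewrite (big_morph (fun b : bool => (-1) ^+ b) (@signr_addb int) sign0).
Qed.

(** The inversions of a permutation can be read off the Vandermonde determinant
    of its word, whose sign is that of the permutation. *)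
Lemma odd_perm_inversions m (s : 'S_m) :
  odd_perm s = \big[addb/false]_(i < m) \big[addb/false]_(j < m | (i < j)%N)
    (s j < s i)%N.
Proof.
(* Permuting the columns of a Vandermonde matrix multiplies its determinant by
   the sign; both determinants are products of differences over [i < j]. *)
have inv : (-1) ^+ s * \prod_(i < m) \prod_(j < m | (i < j)%N) (j%:R - i%:R) =
    \prod_(i < m) \prod_(j < m | (i < j)%N) ((s j)%:R - (s i)%:R) :> int.
  have VE (t : 'I_m -> 'I_m) : \prod_(i < m) \prod_(j < m | (i < j)%N)
      ((t j)%:R - (t i)%:R) = \det (Vandermonde m (\row_j (t j)%:R)) :> int.
    rewrite det_Vandermonde; apply: eq_bigr => i _; apply: eq_bigr => j _.
    by rewrite !mxE.
  rewrite (VE s) (VE id) mulrC -odd_permV -det_perm -det_mulmx -col_permE.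
  by congr (\det _); apply/matrixP => i j; rewrite !mxE.
have := congr1 Num.sg inv; rewrite sgrM.
have sg_prod (F : 'I_m -> 'I_m -> int) :
    Num.sg (\prod_(i < m) \prod_(j < m | (i < j)%N) F i j) =
    \prod_(i < m) \prod_(j < m | (i < j)%N) Num.sg (F i j).
  rewrite (big_morph _ (@sgrM _) (@sgr1 _)); apply: eq_bigr => i _.
  by rewrite (big_morph _ (@sgrM _) (@sgr1 _)).
rewrite !sg_prod big1 => [|i _]; last first.
  by apply: big1 => j ij; rewrite gtr0_sg // subr_gt0 ltr_nat.
rewrite mulr1.
have -> : Num.sg ((-1) ^+ s) = (-1) ^+ s :> int by case: (odd_perm s).
have sgB (i j : 'I_m) : (i < j)%N ->
    Num.sg ((s j)%:R - (s i)%:R) = (-1) ^+ (s j < s i)%N :> int.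
  move=> ij; case: (ltngtP (s j) (s i)) => h.
  - by rewrite ltr0_sg // subr_lt0 ltr_nat.
  - by rewrite gtr0_sg // subr_gt0 ltr_nat.
  - by move/val_inj/perm_inj: h ij => ->; rewrite ltnn.
under eq_bigr => i _ do under eq_bigr => j ij do rewrite sgB //.
under eq_bigr => i _ do rewrite prod_sign.
by rewrite prod_sign => /signr_inj.
Qed.

(** The positions [0, 1, ..., 2h - 1] are grouped into [h] consecutive couples:
    [ev k] and [od k] are the two positions of the [k]-th couple. *)
Section Blocks.
Variable h : nat.

Definition ev (k : 'I_h) : 'I_(h.*2) :=
  Ordinal (etrans (ltn_double k h) (ltn_ord k)).
Fact od_subproof (k : 'I_h) : (k.*2.+1 < h.*2)%N.
Proof. by rewrite ltn_Sdouble. Qed.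
Definition od (k : 'I_h) : 'I_(h.*2) := Ordinal (od_subproof k).

Variant block_spec : 'I_(h.*2) -> Type :=
  | BlockEv k : block_spec (ev k)
  | BlockOd k : block_spec (od k).

Lemma blockP i : block_spec i.
Proof.
have hi : (i./2 < h)%N by rewrite ltn_half_double.
case oi : (odd i).
  suff -> : i = od (Ordinal hi) by constructor.
  by apply: val_inj; rewrite /= -[LHS]odd_double_half oi.
suff -> : i = ev (Ordinal hi) by constructor.
by apply: val_inj; rewrite /= -[LHS]odd_double_half oi.
Qed.

Lemma ev_inj : injective ev.
Proof. by move=> k l /(congr1 val) /= /double_inj /val_inj. Qed.
Lemma od_inj : injective od.
Proof. by move=> k l /(congr1 val) /= [] /double_inj /val_inj. Qed.
Lemma ev_neq_od k l : (ev k == od l) = false.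
Proof.
by apply/eqP => /(congr1 (fun i : 'I__ => odd i)) /=; rewrite !odd_double.
Qed.

Lemma pairing_permP (s : 'S_(h.*2)) :
  reflect ((forall k, (s (ev k) < s (od k))%N) /\
           (forall k l : 'I_h, (k < l)%N -> (s (ev k) < s (ev l))%N))
          (pairing_perm s).
Proof.
apply: (iffP andP) => -[h1 h2]; split.
- move=> k; move/forallP/(_ (ev k))/forallP/(_ (od k))/implyP: h1; apply.
  by rewrite /= odd_double eqxx.
- move=> k l kl; move/forallP/(_ (ev k))/forallP/(_ (ev l))/implyP: h2; apply.
  by rewrite /= !odd_double ltn_double.
- apply/forallP => i; apply/forallP => j; apply/implyP => /andP[].
  case: (blockP i) => k; rewrite /= odd_double //= => _ /eqP ji.
  by rewrite (_ : j = od k) //; apply: val_inj.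
- apply/forallP => i; apply/forallP => j; apply/implyP => /and3P[].
  case: (blockP i) (blockP j) => k [] l; rewrite /= !odd_double //= => _ _.
  by rewrite ltn_double; apply: h2.
Qed.
End Blocks.

Lemma big_blocks (R : Type) (idx : R) (op : Monoid.com_law idx) h (F : 'I_(h.*2) -> R) :
  \big[op/idx]_(i < h.*2) F i = \big[op/idx]_(k < h) op (F (ev k)) (F (od k)).
Proof.
elim: h F => [|h IHh] F; first by rewrite !big_ord0.
pose F' : 'I_(h.*2.+2) -> R := F.
rewrite [RHS]big_ord_recr /= -[LHS]/(\big[op/idx]_(i < h.*2.+2) F' i).
rewrite !big_ord_recr /= IHh -Monoid.mulmA /F'.
congr (op _ (op (F _) (F _))); try exact: val_inj.
by apply: eq_bigr => k _; congr (op (F _) (F _)); apply: val_inj.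
Qed.

Lemma big_consecutive (R : comNzRingType) h (F : 'I_(h.*2) -> 'I_(h.*2) -> R) :
  \prod_(p : 'I_(h.*2) * 'I_(h.*2) | ~~ odd p.1 && (p.2 == p.1.+1 :> nat)) F p.1 p.2 =
  \prod_(k < h) F (ev k) (od k).
Proof.
rewrite -(pair_big_dep xpredT (fun i j : 'I_(h.*2) => ~~ odd i && (j == i.+1 :> nat)) F).
rewrite big_blocks; apply: eq_bigr => k _ /=.
rewrite [X in _ * X]big_pred0 => [|j]; last by rewrite /= odd_double.
rewrite mulr1 (big_pred1 (od k)) // => j.
by rewrite /= odd_double.
Qed.

(** * Pairing permutations and perfect matchings *)

Lemma Pf_even h (A : 'M[int]_(h.*2)) :
  Pf A = \sum_(s : 'S_(h.*2) | pairing_perm s)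
           (-1) ^+ s * \prod_(k < h) A (s (ev k)) (s (od k)).
Proof.
rewrite /Pf odd_double; apply: eq_bigr => s _.
by rewrite (big_consecutive (fun i j => A (s i) (s j))).
Qed.

Section Pairs.
Variables (T : finType) (h : nat) (f : 'I_(h.*2) -> T).
Hypothesis f_inj : injective f.
Implicit Type s : 'S_(h.*2).

Definition block s (k : 'I_h) : {set T} := [set f (s (ev k)); f (s (od k))].
Definition blocks s : {set {set T}} := [set block s k | k : 'I_h].

Lemma mem_block s i k : (f (s i) \in block s k) = (i == ev k) || (i == od k).
Proof. by rewrite !inE !(inj_eq f_inj) !(inj_eq perm_inj). Qed.

Lemma block_neq s k : f (s (ev k)) != f (s (od k)).
Proof. by rewrite (inj_eq f_inj) (inj_eq perm_inj) ev_neq_od. Qed.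

Lemma block_disjoint s k l : k != l -> [disjoint block s k & block s l].
Proof.
move=> kl; rewrite disjoint_subset; apply/subsetP => x.
rewrite !inE => /orP[] /eqP ->; rewrite !(inj_eq f_inj) !(inj_eq perm_inj).
  by rewrite (inj_eq (@ev_inj _)) ev_neq_od orbF.
by rewrite (inj_eq (@od_inj _)) eq_sym ev_neq_od.
Qed.

Lemma blocks_partition s : partition (blocks s) (f @: setT).
Proof.
apply/and3P; split.
- rewrite eqEsubset; apply/andP; split.
    apply/bigcupsP => _ /imsetP[k _ ->]; apply/subsetP => x.
    by rewrite !inE => /orP[] /eqP ->; apply: imset_f.
  apply/subsetP => _ /imsetP[i _ ->]; apply/bigcupP.
  rewrite -(permKV s i); case: (blockP (s^-1%g i)) => k; exists (block s k);
    by rewrite ?imset_f // mem_block eqxx ?orbT.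
- apply/trivIsetP => _ _ /imsetP[k _ ->] /imsetP[l _ ->] kl.
  by apply: block_disjoint; apply: contraNneq kl => ->.
apply/imsetP => -[k _] /esym/eqP; apply/negP/set0Pn.
by exists (f (s (ev k))); rewrite mem_block eqxx.
Qed.

(** The normalisation of [pairing_perm] leaves one word for each pairing: the
    smaller elements occur in increasing order, each followed by its partner. *)
Lemma blocks_inj s t :
  pairing_perm s -> pairing_perm t -> blocks s = blocks t -> s = t.
Proof.
(* Both words list each pair with its smaller element first. *)
have half u w : pairing_perm u -> pairing_perm w -> blocks u = blocks w ->
    forall k, exists l, u (ev k) = w (ev l) /\ u (od k) = w (od l).
  move=> /pairing_permP[pu _] /pairing_permP[pw _] uw k.
  have /imsetP[l _ e] : block u k \in blocks w by rewrite -uw imset_f.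
  exists l; have hu := pu k; have hw := pw l.
  have : f (u (ev k)) \in block w l by rewrite -e mem_block eqxx.
  have : f (u (od k)) \in block w l by rewrite -e mem_block eqxx orbT.
  rewrite !inE !(inj_eq f_inj) => /orP[] /eqP h1 /orP[] /eqP h2 //;
  by move: hu hw; rewrite h1 h2; lia.
move=> ps pt st.
have sorted_ev u : pairing_perm u ->
    sorted ltn [seq val (u (ev k)) | k <- enum 'I_h].
  move=> /pairing_permP[_ pu]; apply: (@homo_sorted _ _ _ (relpre val ltn)).
    by move=> k l; apply: pu.
  by rewrite -sorted_map val_enum_ord iota_ltn_sorted.
have sub u w : pairing_perm u -> pairing_perm w -> blocks u = blocks w ->
    {subset [seq val (u (ev k)) | k <- enum 'I_h] <=
            [seq val (w (ev k)) | k <- enum 'I_h]}.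
  move=> pu pw uw _ /mapP[k _ ->]; have [l [-> _]] := half u w pu pw uw k.
  by apply: map_f; rewrite mem_enum.
(* The smaller elements form an increasing list, which their set determines. *)
have : [seq val (s (ev k)) | k <- enum 'I_h] = [seq val (t (ev k)) | k <- enum 'I_h].
  apply: (irr_sorted_eq ltn_trans ltnn (sorted_ev s ps) (sorted_ev t pt)) => x.
  by apply/idP/idP; apply: sub.
move/eq_in_map => ev_eq.
have {}ev_eq k : s (ev k) = t (ev k).
  by apply: val_inj; apply: ev_eq; rewrite mem_enum.
apply/permP => i; case: (blockP i) => k //.
have [l [e1 e2]] := half s t ps pt st k.
by move: e1; rewrite ev_eq e2 => /perm_inj/ev_inj ->.
Qed.

Definition half_ord (i : 'I_(h.*2)) : 'I_h :=
  Ordinal (etrans (ltn_half_double i h) (ltn_ord i)).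

Lemma half_ev k : half_ord (ev k) = k.
Proof. by apply: val_inj; rewrite /= doubleK. Qed.
Lemma half_od k : half_ord (od k) = k.
Proof. by apply: val_inj; rewrite /= uphalf_double. Qed.

(** The word is obtained by listing in increasing order the indices that precede
    their partner, each followed by its partner. *)
Lemma blocks_surj (M : {set {set T}}) :
  partition M (f @: setT) -> (forall B, B \in M -> #|B| = 2) ->
  exists2 s, pairing_perm s & blocks s = M.
Proof.
move=> /and3P[/eqP covM trivM _] card2.
have partner i : exists j, (j != i) && ([set f i; f j] \in M).
  have fi : f i \in cover M by rewrite covM imset_f.
  have BM := pblock_mem fi; have iB : f i \in pblock M (f i) by rewrite mem_pblock.
  move/eqP/cards2P: (card2 _ BM) => [x [y [xy BE]]].
  have [z zi Bz] : exists2 z, z != f i & pblock M (f i) = [set f i; z].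
    move: iB; rewrite BE !inE => /orP[] /eqP fie.
      by exists y; rewrite fie // eq_sym.
    by exists x; rewrite fie // setUC.
  have /imsetP[j _ zj] : z \in f @: setT.
    by rewrite -covM; apply/bigcupP; exists (pblock M (f i)); rewrite // Bz !inE eqxx orbT.
  by exists j; rewrite -zj -Bz BM andbT; apply: contraNneq zi => <-; rewrite zj.
have /fin_all_exists[tau tauP] := partner.
have tau_neq i : tau i != i by case/andP: (tauP i).
have tauM i : [set f i; f (tau i)] \in M by case/andP: (tauP i).
have tau_uniq i j : j != i -> [set f i; f j] \in M -> j = tau i.
  move=> ji ijM; have e : [set f i; f j] = [set f i; f (tau i)].
    rewrite -(def_pblock trivM ijM (_ : f i \in _)) ?inE ?eqxx //.
    by rewrite -(def_pblock trivM (tauM i) (_ : f i \in _)) ?inE ?eqxx.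
  have : f j \in [set f i; f (tau i)] by rewrite -e !inE eqxx orbT.
  by rewrite !inE !(inj_eq f_inj) (negbTE ji) => /eqP.
have tauK : involutive tau.
  by move=> i; apply/esym/tau_uniq; rewrite 1?eq_sym // setUC.
pose low : {pred 'I_(h.*2)} := [pred i : 'I_(h.*2) | (i < tau i)%N].
(* [tau] exchanges [low] with its complement. *)
have card_low : #|low| = h.
  have : (#|low| + #|[predC low]| = h.*2)%N by rewrite cardC card_ord.
  have -> : #|[predC low]| = #|low|.
    rewrite -(card_image (inv_inj tauK) low); apply: eq_card => i.
    rewrite -[i in RHS]tauK (mem_image (inv_inj tauK)) !inE tauK -leqNgt leq_eqVlt.
    by rewrite val_eqE (negbTE (tau_neq i)).
  by rewrite addnn => /double_inj.
pose L : h.-tuple 'I_(h.*2) := tcast card_low (enum_tuple low).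
have L_enum : L = enum low :> seq _ by rewrite /L val_tcast.
have L_low k : (tnth L k < tau (tnth L k))%N.
  by have := mem_tnth k L; rewrite memtE L_enum mem_enum inE.
have L_uniq : uniq L by rewrite L_enum enum_uniq.
pose sf i := let x := tnth L (half_ord i) in if odd i then tau x else x.
have sf_ev k : sf (ev k) = tnth L k by rewrite /sf half_ev /= odd_double.
have sf_od k : sf (od k) = tau (tnth L k) by rewrite /sf half_od /= odd_double.
have L_tau k l : tnth L k <> tau (tnth L l).
  move=> e; have := L_low k; have := L_low l; rewrite e tauK.
  by move=> h1 /(ltn_trans h1); rewrite ltnn.
have sf_inj : injective sf.
  move=> i j; case: (blockP i) => k; case: (blockP j) => l; rewrite ?sf_ev ?sf_od.
  - by move/(tuple_uniqP _ L_uniq) => ->.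
  - by move/L_tau.
  - by move/esym/L_tau.
  - by move/(inv_inj tauK)/(tuple_uniqP _ L_uniq) => ->.
exists (perm sf_inj).
  apply/pairing_permP; split=> k; rewrite ?permE ?sf_ev ?sf_od //.
  move=> l kl; rewrite !permE !sf_ev !(tnth_nth (ev k)).
  have L_sorted : sorted ltn [seq val i | i <- L].
    rewrite L_enum sorted_map /enum_mem; apply: sorted_filter.
      by move=> ? ? ?; apply: ltn_trans.
    by rewrite -sorted_map -enumT val_enum_ord iota_ltn_sorted.
  have := sorted_ltn_nth ltn_trans 0 L_sorted k l.
  rewrite !inE size_map size_tuple !ltn_ord => /(_ isT isT kl).
  by rewrite !(nth_map (ev k)) ?size_tuple.
apply/setP => B; apply/imsetP/idP => [[k _ ->]|BM].
  by rewrite /block !permE sf_ev sf_od.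
have [i iB] : exists i, B = [set f i; f (tau i)].
  move/eqP/cards2P: (card2 _ BM) => [x [y [xy BE]]].
  have mem z : z \in B -> exists i, z = f i.
    move=> zB; have /imsetP[i _ ->] : z \in f @: setT.
      by rewrite -covM; apply/bigcupP; exists B.
    by exists i.
  have [i xi] : exists i, x = f i by apply: mem; rewrite BE !inE eqxx.
  have [j yj] : exists j, y = f j by apply: mem; rewrite BE !inE eqxx orbT.
  exists i; rewrite -(tau_uniq i j) -?xi -?yj -?BE //.
  by apply: contraNneq xy => ji; rewrite xi yj ji.
wlog ilow : i iB / low i.
  move=> wl; have [lti|] := boolP (low i); first exact: (wl i).
  rewrite /low /= -leqNgt leq_eqVlt val_eqE (negbTE (tau_neq i)) /= => h1.
  by apply: (wl (tau i)); rewrite /low /= ?tauK // setUC.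
have : i \in L by rewrite memtE L_enum mem_enum.
case/tnthP => k ik; exists k => //.
by rewrite /block !permE sf_ev sf_od -ik.
Qed.

Lemma card_matchings (E : {set {set T}}) : (forall e, e \in E -> #|e| = 2) ->
  #|[set M : {set {set T}} | (M \subset E) && partition M (f @: setT)]| =
  #|[set s : 'S_(h.*2) | pairing_perm s & blocks s \subset E]|.
Proof.
move=> E2; rewrite -(card_in_imset (f := blocks)).
  apply: eq_card => M; rewrite inE; apply/andP/imsetP => [[ME partM]|[s]].
    have [s ps sM] := blocks_surj partM (fun B BM => E2 B (subsetP ME B BM)).
    by exists s; rewrite // inE ps sM.
  by rewrite inE => /andP[ps sE] ->; rewrite blocks_partition.
by move=> s t; rewrite !inE => /andP[ps _] /andP[pt _]; apply: blocks_inj.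
Qed.


(** Inversions only occur between different pairs.  The hypothesis splits the
    inversions between two pairs into a contribution of each; gathering the
    contributions of one pair gives a sum over all elements outside it. *)
Lemma odd_pairing_perm s (gt : rel T) (kappa : {set T} -> T -> bool) :
  (forall i j, gt (f i) (f j) = (j < i)%N) -> pairing_perm s ->
  (forall k l, k != l ->
     \big[addb/false]_(a in block s k) \big[addb/false]_(b in block s l) gt a b =
     \big[addb/false]_(b in block s l) kappa (block s k) b (+)
     \big[addb/false]_(a in block s k) kappa (block s l) a) ->
  odd_perm s = \big[addb/false]_(k < h)
    \big[addb/false]_(x in f @: setT | x \notin block s k) kappa (block s k) x.
Proof.
move=> gtE /pairing_permP[ps _] exch.
have sum2 k (F : T -> bool) :
    \big[addb/false]_(a in block s k) F a = F (f (s (ev k))) (+) F (f (s (od k))).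
  by rewrite big_addb_set2 ?block_neq.
pose F k l := \big[addb/false]_(b in block s l) kappa (block s k) b.
transitivity (\big[addb/false]_(k < h) \big[addb/false]_(l < h | (k < l)%N)
   (F k l (+) F l k)).
  rewrite odd_perm_inversions.
  transitivity (\big[addb/false]_(i < h.*2) \big[addb/false]_(j < h.*2)
     ((i < j) && (s j < s i))%N).
    by apply: eq_bigr => i _; rewrite big_mkcond.
  rewrite big_blocks; apply: eq_bigr => k _; rewrite !big_blocks -big_split.
  rewrite [RHS]big_mkcond; apply: eq_bigr => l _ /=.
  rewrite !ltnS !ltn_double leq_double ltn_Sdouble.
  case: ltngtP => [kl|//|/val_inj ->].
    have kl' : k != l by rewrite -val_eqE ltn_eqF.
    by rewrite /F -exch // !sum2 !gtE /= addbACA.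
  by have -> : (s (od l) < s (ev l))%N = false by rewrite ltnNge ltnW.
under eq_bigr => k _ do rewrite big_split.
rewrite big_split /= [X in _ (+) X](exchange_big_dep xpredT) //= -big_split.
apply: eq_bigr => k _ /=.
transitivity (\big[addb/false]_(l < h | l != k) F k l).
  rewrite [LHS]addbC big_mkcond [X in _ (+) X]big_mkcond -big_split /=.
  rewrite [RHS]big_mkcond; apply: eq_bigr => l _.
  by rewrite -val_eqE /=; case: ltngtP; rewrite ?addbF.
rewrite big_mkcondr big_imset; last by move=> ? ? _ _ /f_inj.
rewrite [RHS](reindex_inj (@perm_inj _ s)) /= big_mkcond /=.
under [RHS]eq_bigl do rewrite inE.
rewrite big_blocks; apply: eq_bigr => l _.
rewrite !mem_block !(inj_eq (@ev_inj _)) !(inj_eq (@od_inj _)) ev_neq_od orbF.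
rewrite [od l == ev k]eq_sym ev_neq_od /= /F sum2.
by case: eqP.
Qed.
End Pairs.

(** The signs of [A] are those that [odd_pairing_perm] gives to the pairs, so each
    pairing that is a matching contributes 1; the other pairings meet a zero
    entry. *)
Theorem Pf_counts_matchings (T : finType) m (f : 'I_m -> T) (E : {set {set T}})
    (gt : rel T) (kappa : {set T} -> T -> bool) (A : 'M[int]_m) :
  injective f -> (forall e, e \in E -> #|e| = 2) ->
  (forall i j, gt (f i) (f j) = (j < i)%N) ->
  (forall e e', e \in E -> e' \in E -> [disjoint e & e'] ->
     \big[addb/false]_(a in e) \big[addb/false]_(b in e') gt a b =
     \big[addb/false]_(b in e') kappa e b (+)
     \big[addb/false]_(a in e) kappa e' a) ->
  (forall i j, A i j = let e := [set f i; f j]%SET in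
     if e \in E then
       (-1) ^+ ((j < i)%N (+)
          \big[addb/false]_(x in (f @: [set: 'I_m])%SET | x \notin e) kappa e x)
     else 0) ->
  Pf A = #|[set M : {set {set T}} | (M \subset E) &&
             partition M (f @: [set: 'I_m])%SET]|%:Z.
Proof.
move=> f_inj E2 gtE exch AE.
have [m_odd|] := boolP (odd m).
  rewrite /Pf m_odd (_ : #|_| = 0) //; apply/eqP; rewrite cards_eq0.
  apply/eqP/setP => M; rewrite !inE; apply/negP => /andP[/subsetP ME partM].
  have := card_uniform_partition (fun e eM => E2 e (ME e eM)) partM.
  rewrite card_imset // cardsT card_ord => mE.
  by rewrite mE oddM andbF in m_odd.
move=> m_even; have [h mE] : exists h, m = h.*2.
  by exists m./2; rewrite -[LHS]odd_double_half (negbTE m_even).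
subst m; rewrite Pf_even card_matchings // -sum1_card.
rewrite (big_morph Posz PoszD (erefl _)) [RHS]big_mkcond.
rewrite [LHS]big_mkcond; apply: eq_bigr => s _; rewrite inE.
case: (boolP (pairing_perm s)) => //= ps; have [sE|] := boolP (_ \subset _); last first.
  case/subsetPn => _ /imsetP[k _ ->] kE.
  by rewrite (bigD1 k) //= AE /= -/(block f s k) (negbTE kE) mul0r mulr0.
have bE k : block f s k \in E by apply: (subsetP sE); apply: imset_f.
have sgn := odd_pairing_perm f_inj gtE ps
  (fun k l kl => exch _ _ (bE k) (bE l) (block_disjoint f_inj s kl)).
rewrite {1}sgn -prod_sign -big_split big1 // => k _ /=.
rewrite AE /= -/(block f s k) bE.
have /pairing_permP[/(_ k) /ltnW sk _] := ps.
by rewrite ltnNge sk -signr_addb addbb.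
Qed.

Lemma edgesP (G : bgraph) (e : {set G}) :
  reflect (exists x y, adj x y /\ e = [set x; y]%SET) (e \in edges G).
Proof.
apply: (iffP imsetP) => [[[x y]]|[x [y [xy ->]]]].
  by rewrite inE /= => xy ->; exists x, y.
by exists (x, y); rewrite ?inE.
Qed.

Lemma edge_adj (G : bgraph) (x y : G) : ([set x; y]%SET \in edges G) = adj x y.
Proof.
apply/edgesP/idP => [[a [b [ab e]]]|xy]; last by exists x, y.
have ne : a != b by apply: contraTneq ab => ->; rewrite adj_irrefl.
have : x \in [set a; b]%SET by rewrite -e !inE eqxx.
have : y \in [set a; b]%SET by rewrite -e !inE eqxx orbT.
have : #|[set x; y]%SET| = 2 by rewrite e cards2 ne.
rewrite cards2; case: eqP => // /eqP xy _.
rewrite !inE => /orP[] /eqP hy /orP[] /eqP hx; move: xy; rewrite hx hy ?eqxx //.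
by rewrite adj_sym.
Qed.

Lemma edge_card (G : bgraph) (e : {set G}) : e \in edges G -> #|e| = 2.
Proof.
case/edgesP => x [y [xy ->]]; rewrite cards2.
by case: eqP xy => // ->; rewrite adj_irrefl.
Qed.

(** A matching with boundary [I] partitions the set of vertices that it covers,
    which is determined by [I]. *)
Lemma num_matchingsE (G : bgraph) (I : {set G}) : I \subset boundary G ->
  num_matchings I = #|[set M : {set {set G}} | (M \subset edges G) &&
                        partition M (~: boundary G :|: I)%SET]|.
Proof.
move=> Isub; rewrite /num_matchings; congr #|pred_of_set _|; apply/setP => M.
rewrite !inE /perfect_matching; case: (boolP (M \subset edges G)) => //= ME.
have coverE x : (x \in cover M) = (0 < cover_degree M x)%N.
  rewrite /cover_degree; apply/bigcupP/card_gt0P => [[e eM xe]|[e]].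
    by exists e; rewrite inE eM.
  by rewrite inE => /andP[]; exists e.
have trivE : trivIset M = [forall x, (cover_degree M x <= 1)%N].
  apply/trivIsetP/forallP => [triv x|deg e f eM fM ef].
    apply/card_le1_eqP => e f; rewrite !inE => /andP[eM xe] /andP[fM xf].
    apply/eqP; apply: contraTT xf => ef.
    by rewrite (disjointFr (triv _ _ _ _ _) xe) // eq_sym.
  rewrite -setI_eq0; apply/set0Pn => -[x]; rewrite inE => /andP[xe xf].
  move/card_le1_eqP: (deg x) => /(_ e f); rewrite !inE eM fM xe xf => /(_ isT isT) efE.
  by rewrite efE eqxx in ef.
have M0 : (set0 \notin M).
  by apply/negP => /(subsetP ME)/edge_card; rewrite cards0.
rewrite /partition M0 andbT trivE.
apply/andP/andP => [[/andP[/forall_inP int /forall_inP bnd] /eqP mb]|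
                    [/eqP cov /forallP deg]].
  split; last first.
    apply/forallP => x; have [/bnd //|/int] := boolP (x \in boundary G).
    by move/eqP->.
  rewrite -mb; apply/eqP/setP => x; rewrite in_setU in_setC in_setI coverE.
  by have [|/int] := boolP (x \in boundary G); last move/eqP->.
split.
  apply/andP; split; apply/forall_inP => x xb //.
  by rewrite eqn_leq deg -coverE cov in_setU in_setC xb.
rewrite /matching_boundary cov; apply/eqP/setP => x; rewrite in_setI in_setU in_setC.
case: (boolP (x \in boundary G)) => //= xb.
by apply/esym/negbTE; apply: contra xb; apply: (subsetP Isub).
Qed.

Lemma enum_val_mono p (J : {set 'I_p}) (i j : 'I_#|J|) :
  (enum_val i < enum_val j)%N = (i < j)%N.
Proof.
have homo (k l : 'I_#|J|) : (k < l)%N -> (enum_val k < enum_val l)%N.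
  move=> kl; have J_sorted : sorted ltn [seq val x | x <- enum J].
    rewrite sorted_map /enum_mem; apply: sorted_filter.
      by move=> ? ? ?; apply: ltn_trans.
    by rewrite -sorted_map -enumT val_enum_ord iota_ltn_sorted.
  have := sorted_ltn_nth ltn_trans 0 J_sorted k l.
  rewrite !inE size_map -cardE !ltn_ord => /(_ isT isT kl).
  by rewrite !(nth_map (enum_val k)) -?cardE // -!enum_val_nth.
case: (ltngtP i j) => [/homo->//|/homo/ltnW|/val_inj ->]; last by rewrite ltnn.
by rewrite leqNgt => /negbTE.
Qed.

From mathcomp Require Import boolp classical_sets reals topology normedtype trigo.
Import numFieldNormedType.Exports.

(** * Complex square roots and half-turns *)

Lemma telescope_addb n (f : nat -> bool) :
  \big[addb/false]_(i < n) (f i (+) f i.+1) = f 0 (+) f n.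
Proof.
elim: n => [|n IHn]; first by rewrite big_ord0 addbb.
by rewrite big_ord_recr /= IHn addbA addbK.
Qed.

Section SquareRoots.
Variable R : realType.
Implicit Types u v w r s z : R * R.

(** The plane is the complex line: [quarter_turn] is multiplication by [i],
    [csqr] is [z ^ 2], and [dot u v] is the real part of [u] times the conjugate
    of [v].  The lemmas below hold for any section [csqrt] of
    [csqr], continuous or not. *)
Definition dot u v : R := u.1 * v.1 + u.2 * v.2.
Definition quarter_turn u : R * R := (- u.2, u.1).
Definition csqr r : R * R := (r.1 ^+ 2 - r.2 ^+ 2, 2 * r.1 * r.2).
Definition csqrt u : R * R :=
  let z := complex.sqrtc (complex.Complex u.1 u.2) in
  (complex.Re z, complex.Im z).

Lemma csqrtK : cancel csqrt csqr.
Proof.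
move=> [a b]; rewrite /csqrt /csqr.
have := complex.sqr_sqrtc (complex.Complex a b).
case: (complex.sqrtc _) => x y; rewrite expr2 => -[/= <- <-].
by congr pair; ring.
Qed.

Lemma csqr_inj r s : csqr r = csqr s -> r = s \/ r = - s.
Proof.
case: r s => [a b] [c d] [/= h1 h2].
have h : ((a - c) ^+ 2 + (b - d) ^+ 2) * ((a + c) ^+ 2 + (b + d) ^+ 2) = 0.
  transitivity ((a ^+ 2 - b ^+ 2 - (c ^+ 2 - d ^+ 2)) ^+ 2 +
                (2 * a * b - 2 * c * d) ^+ 2); first by ring.
  by rewrite h1 h2 !subrr expr0n addr0.
move/eqP: h; rewrite mulf_eq0 !paddr_eq0 ?sqr_ge0 // !sqrf_eq0 !subr_eq0 !addr_eq0.
by case/orP=> /andP[/eqP -> /eqP ->]; [left|right].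
Qed.

Lemma dotC u v : dot u v = dot v u.
Proof. by rewrite /dot mulrC [u.2 * _]mulrC. Qed.

Lemma dot_quarter_turn u v : dot (quarter_turn u) (quarter_turn v) = dot u v.
Proof. by rewrite /dot /= mulrNN addrC. Qed.

Lemma dot_csqr r s :
  dot (csqr r) (csqr s) = dot r s ^+ 2 - dot r (quarter_turn s) ^+ 2.
Proof. by rewrite /dot /csqr /=; ring. Qed.

Lemma csqr_quarter_turn r : csqr (quarter_turn r) = - csqr r.
Proof.
rewrite -[RHS]/(- (csqr r).1, - (csqr r).2) /csqr /=.
by congr pair; ring.
Qed.

(** On the half-plane of vectors making an acute angle with [csqr s] there is a
    continuous square root, equal to [s] at [csqr s]; [side s u] tells whether
    [csqrt u] is opposite to it. *)
Definition side s u : bool := dot (csqrt u) s < 0.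
(** The change of sign of [csqrt], relative to a continuous root, on a short path
    from [u] to [v]. *)
Definition turn u v : bool := side (csqrt v) u.

(** On a half-plane the sign changes of [csqrt] form a coboundary: two roots in
    the continuous branch make an acute angle. *)
Lemma side_turn s u v :
  0 < dot u (csqr s) -> 0 < dot v (csqr s) ->
  turn u v = side s u (+) side s v.
Proof.
rewrite /turn /side -{1}(csqrtK u) -{1}(csqrtK v).
move: (csqrt u) (csqrt v) => [a b] [c d]; case: s => x y.
rewrite /dot /csqr /=.
(* [P], [Q] are the coordinates of the first root in the frame of [s], and [P'],
   [Q'] those of the second; the half-plane condition says that [P ^ 2 > Q ^ 2]. *)
set P := a * x + b * y; set P' := c * x + d * y.
set Q := a * y - b * x; set Q' := c * y - d * x.
set D := a * c + b * d => hu hv.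
have {}hu : 0 < P ^+ 2 - Q ^+ 2 by rewrite /P /Q; nra.
have {}hv : 0 < P' ^+ 2 - Q' ^+ 2 by rewrite /P' /Q'; nra.
have e : D * (x ^+ 2 + y ^+ 2) = P * P' + Q * Q'.
  by rewrite /P /Q /P' /Q' /D; ring.
have n0 : 0 <= x ^+ 2 + y ^+ 2 by rewrite addr_ge0 ?sqr_ge0.
have hq : `|Q * Q'| < `|P * P'|.
  rewrite !normrM ltr_pM ?normr_ge0 // -(ltr_pXn2r (n:=2)) ?nnegrE ?normr_ge0 //;
  by rewrite !real_normK ?num_real // -subr_gt0.
have sg : (P * P' + Q * Q' < 0) = (P * P' < 0).
  move: hq; rewrite ltr_norml; case: (ltrP (P * P') 0) => h /andP[h1 h2].
    by apply/idP; rewrite ltr0_norm // in h1 h2; lra.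
  by apply/negbTE; rewrite -leNgt; rewrite ger0_norm // in h1 h2; lra.
have PP : P * P' != 0.
  by rewrite -normr_gt0; apply: le_lt_trans hq; apply: normr_ge0.
have -> : (D < 0) = (P * P' < 0).
  rewrite -sg -e; case: (ltrP D 0) => hD.
    symmetry; rewrite lt_neqAle; apply/andP; split; last by nra.
    by apply: contraNneq PP => h; rewrite -normr_le0; nra.
  by apply/esym/negbTE; rewrite -leNgt; nra.
move: PP; rewrite mulf_eq0 negb_or => /andP[P0 P'0].
case: (ltrP P 0) => hP; case: (ltrP P' 0) => hP' /=.
- by apply/negbTE; rewrite -leNgt; nra.
- by rewrite nmulr_rlt0 // lt_neqAle eq_sym P'0.
- by rewrite pmulr_rlt0 // lt_neqAle eq_sym P0.
- by apply/negbTE; rewrite -leNgt; nra.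
Qed.

(** The sign by which [csqrt (- u)] differs from [i] times [csqrt u]. *)
Definition flip u : bool := side (quarter_turn (csqrt u)) (- u).

Lemma csqrt0 : csqrt 0 = 0.
Proof.
have : csqr (csqrt 0) = csqr 0.
  by rewrite csqrtK /csqr /= expr0n mulr0 subrr.
by case/csqr_inj => ->; rewrite ?oppr0.
Qed.

Lemma csqrt_neq0 u : u != 0 -> csqrt u != 0.
Proof.
apply: contraNneq => h; rewrite -(csqrtK u) h /csqr /= !expr0n mulr0 subrr.
by [].
Qed.

Lemma dot_gt0 u : u != 0 -> 0 < dot u u.
Proof.
case: u => a b; rewrite -pair_eqE negb_and /dot /= -!expr2 => /orP[] h.
  by rewrite ltr_wpDr ?sqr_ge0 // lt_neqAle sqr_ge0 eq_sym sqrf_eq0 h.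
by rewrite ltr_wpDl ?sqr_ge0 // lt_neqAle sqr_ge0 eq_sym sqrf_eq0 h.
Qed.

Lemma csqrtN u : u != 0 ->
  csqrt (- u) = (-1) ^+ flip u *: quarter_turn (csqrt u).
Proof.
move=> u0; rewrite /flip /side.
have q0 : 0 < dot (quarter_turn (csqrt u)) (quarter_turn (csqrt u)).
  by rewrite dot_quarter_turn dot_gt0 // csqrt_neq0.
have : csqr (csqrt (- u)) = csqr (quarter_turn (csqrt u)).
  by rewrite csqr_quarter_turn !csqrtK.
case/csqr_inj => ->.
  by rewrite ltNge ltW //= expr0 scale1r.
have -> : dot (- quarter_turn (csqrt u)) (quarter_turn (csqrt u)) =
   - dot (quarter_turn (csqrt u)) (quarter_turn (csqrt u)).
   by rewrite /dot /=; ring.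
by rewrite oppr_lt0 q0 expr1 scaleN1r.
Qed.

Lemma dotZ (b b' : bool) u v :
  dot ((-1) ^+ b *: u) ((-1) ^+ b' *: v) = (-1) ^+ (b (+) b') * dot u v.
Proof.
rewrite signr_addb /dot /= /GRing.scale /=.
by ring.
Qed.

Lemma sign_mul_lt0 (b : bool) (x : R) : x != 0 ->
  ((-1) ^+ b * x < 0) = b (+) (x < 0).
Proof.
case: b => x0; rewrite ?expr0 ?mul1r //= expr1 mulN1r oppr_lt0.
by rewrite -leNgt le_eqVlt eq_sym (negbTE x0).
Qed.

Lemma turn_quarter_turn (b b' : bool) u v u' v' :
  csqrt u' = (-1) ^+ b *: quarter_turn (csqrt u) ->
  csqrt v' = (-1) ^+ b' *: quarter_turn (csqrt v) ->
  0 < dot u v -> turn u' v' = turn u v (+) (b (+) b').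
Proof.
move=> eu ev uv; rewrite /turn /side eu ev dotZ dot_quarter_turn sign_mul_lt0.
  by rewrite addbC.
apply: contraTneq uv => d0.
by rewrite -(csqrtK u) -(csqrtK v) dot_csqr d0 -leNgt expr0n sub0r oppr_le0 sqr_ge0.
Qed.

Lemma turnN u v : 0 < dot u v ->
  turn (- u) (- v) = turn u v (+) (flip u (+) flip v).
Proof.
move=> uv; apply: turn_quarter_turn (uv); apply: csqrtN.
  by apply: contraTneq uv => ->; rewrite /dot /= !mul0r addr0 ltxx.
by apply: contraTneq uv => ->; rewrite /dot /= !mulr0 addr0 ltxx.
Qed.

Lemma flipN u : u != 0 -> flip (- u) = ~~ flip u.
Proof.
move=> u0; rewrite /flip /side opprK.
move: (csqrtN u0) (csqrt_neq0 u0); move: (flip u) (csqrt (- u)) (csqrt u).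
move=> b s r -> r0.
have -> : dot r (quarter_turn ((-1) ^+ b *: quarter_turn r)) = - ((-1) ^+ b * dot r r).
  by rewrite /dot /= /GRing.scale /=; ring.
have -> : dot ((-1) ^+ b *: quarter_turn r) (quarter_turn r) = (-1) ^+ b * dot r r.
  by rewrite /dot /= /GRing.scale /=; ring.
rewrite oppr_lt0 -leNgt le_eqVlt eq_sym mulf_eq0 signr_eq0 /=.
by rewrite gt_eqF // dot_gt0.
Qed.

(** Let [a] and [b] be the points of a circle of radius [rho] at angles [2 alpha]
    and [2 beta], with [za] and [zb] the unit vectors at [alpha] and [beta] and
    [0 < beta - alpha < pi].  The canonical branches at [a] and [b] select roots of
    [b - a] and of [a - b], and the second root is [i] times the first: the chord has
    direction [alpha + beta + pi / 2], so its roots make equal angles with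
    [zb] and with [quarter_turn za]. *)
Lemma flip_circle_chord (rho : R) (za zb a b : R * R) :
  0 < rho -> dot za za = 1 -> dot zb zb = 1 ->
  0 < dot zb (quarter_turn za) ->
  b - a = rho *: (csqr zb - csqr za) ->
  side (quarter_turn zb) (a - b) (+) side (quarter_turn za) (b - a) = flip (b - a).
Proof.
move=> rho0 na nb pos eu.
rewrite -(opprB b a); set u := b - a in eu *.
have h1 : (csqr (csqrt u)).1 = rho * ((csqr zb).1 - (csqr za).1).
  by rewrite csqrtK eu.
have h2 : (csqr (csqrt u)).2 = rho * ((csqr zb).2 - (csqr za).2).
  by rewrite csqrtK eu.
(* In the frame of [zb], with [r = csqrt u = p + i q], the identity for [r ^ 2]
   gives [p ^ 2 - q ^ 2 = 2 rho (Im za) ^ 2 > 0] and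
   [p q = - rho (Re za) (Im za)]. *)
have key : 0 < dot (csqrt u) zb * dot (csqrt u) (quarter_turn za) /\
    dot (csqrt u) zb != 0.
  move: na nb h2 h1 pos; clear eu; clearbody u.
  move: (csqrt u) => [x y]; case: za zb => [al be] [c d]; rewrite /dot /csqr /=.
  move=> na nb h2 h1 pos.
  set q := y * c - x * d; set p := x * c + y * d.
  have pq : p * q = - rho * ((al * c + be * d) * (be * c - al * d)).
    transitivity (((2 * x * y) * (c ^+ 2 - d ^+ 2) - 2 * (x ^+ 2 - y ^+ 2) * (c * d)) / 2).
      by rewrite /p /q; field.
    by rewrite h1 h2; field.
  have p2 : p ^+ 2 - q ^+ 2 = 2 * rho * (be * c - al * d) ^+ 2.
    transitivity ((x ^+ 2 - y ^+ 2) * (c ^+ 2 - d ^+ 2) + (2 * x * y) * (2 * c * d)).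
      by rewrite /p /q; ring.
    transitivity (rho * ((c * c + d * d) ^+ 2 - ((al * c + be * d) ^+ 2 -
      (be * c - al * d) ^+ 2))); first by rewrite h1 h2; ring.
    have -> : rho * ((c * c + d * d) ^+ 2 -
      ((al * c + be * d) ^+ 2 - (be * c - al * d) ^+ 2)) =
      rho * ((c * c + d * d) ^+ 2 - (al * al + be * be) * (c * c + d * d) +
         2 * (be * c - al * d) ^+ 2) by ring.
    by rewrite na nb; ring.
  have b0 : 0 < al * d - be * c by lra.
  have p0 : 0 < p ^+ 2.
    have : 0 < 2 * rho * (be * c - al * d) ^+ 2.
      by rewrite -sqrrN opprB !mulr_gt0.
    by rewrite -p2; have := sqr_ge0 q; lra.
  split; last by rewrite -sqrf_eq0 gt_eqF.
  have prod : p * (x * - be + y * al) * (c * c + d * d) =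
      p ^+ 2 * (al * d - be * c) + p * q * (al * c + be * d).
     by rewrite /p /q; ring.
  move: prod; rewrite nb mulr1 => ->; rewrite pq.
  have -> : p ^+ 2 * (al * d - be * c) +
      - rho * ((al * c + be * d) * (be * c - al * d)) * (al * c + be * d) =
    (al * d - be * c) * (p ^+ 2 + rho * (al * c + be * d) ^+ 2) by ring.
  by rewrite mulr_gt0 // ltr_wpDr // mulr_ge0 ?sqr_ge0 // ltW.
have u0 : u != 0.
  apply: contraTneq key.1 => u0.
  by rewrite u0 csqrt0 /dot /= !mul0r addr0 mul0r ltxx.
have [{}key d0] := key.
have -> : side (quarter_turn zb) (- u) = flip u (+) (dot (csqrt u) zb < 0).
  rewrite /side (csqrtN u0) -sign_mul_lt0 //; congr (_ < _).
  by rewrite /dot /= /GRing.scale /=; ring.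
rewrite /side.
suff -> : (dot (csqrt u) (quarter_turn za) < 0) = (dot (csqrt u) zb < 0).
  by rewrite addbK.
move: d0 key; rewrite neq_lt => /orP[] h.
  by rewrite h nmulr_rgt0 // => ->.
by rewrite pmulr_rgt0 // => h'; rewrite !ltNge !ltW.
Qed.


Implicit Types p q : nat -> R * R.

(** The monodromy of the square root of [p i - w] along the sampled path. *)
Definition winding n p w : bool :=
  \big[addb/false]_(i < n) turn (p i - w) (p i.+1 - w).

(** The differences [p i - q j] at the four corners of each cell of the grid lie
    in the half-plane around the difference at the lower corner. *)
Definition finely_separated n p q : Prop :=
  forall i j i' j', (i <= i' <= i.+1)%N -> (j <= j' <= j.+1)%N ->
    (i' <= n)%N -> (j' <= n)%N ->
    0 < dot (p i' - q j') (p i - q j).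

(** A discrete Green formula modulo 2. *)
Lemma grid_boundary n (H V : nat -> nat -> bool) :
  (forall i j, (i < n)%N -> (j < n)%N ->
     H i j (+) H i j.+1 = V i j (+) V i.+1 j) ->
  \big[addb/false]_(i < n) H i 0 (+) \big[addb/false]_(i < n) H i n =
  \big[addb/false]_(j < n) V 0 j (+) \big[addb/false]_(j < n) V n j.
Proof.
move=> cell; rewrite -!big_split /=.
transitivity (\big[addb/false]_(i < n) \big[addb/false]_(j < n)
   (H i j (+) H i j.+1)).
  by apply: eq_bigr => i _; exact/esym/(telescope_addb _ (H i)).
transitivity (\big[addb/false]_(i < n) \big[addb/false]_(j < n)
   (V i j (+) V i.+1 j)).
  by apply: eq_bigr => i _; apply: eq_bigr => j _; apply: cell.
rewrite exchange_big; apply: eq_bigr => j _ /=.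
exact/(telescope_addb _ (V^~ j)).
Qed.

(** The square root of [p i - q j] has no monodromy around a cell, because the
    four differences lie in a half-plane, hence none around the whole grid.  On
    two sides of the grid the difference is the opposite of the one that defines
    the winding of [q]; this accounts for the terms [flip]. *)
Lemma winding_exchange n p q : finely_separated n p q ->
  winding n p (q 0) (+) winding n p (q n) (+)
    (winding n q (p 0) (+) winding n q (p n)) =
  flip (q 0 - p 0) (+) flip (q n - p 0) (+)
    (flip (q 0 - p n) (+) flip (q n - p n)).
Proof.
move=> sep.
have V i : (i <= n)%N ->
   \big[addb/false]_(j < n) turn (p i - q j) (p i - q j.+1) =
   winding n q (p i) (+) (flip (q 0 - p i) (+) flip (q n - p i)).
  move=> le_in.
  rewrite -(telescope_addb n (fun j => flip (q j - p i))) -big_split.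
  apply: eq_bigr => j _ /=.
  rewrite -(opprB (q j)) -(opprB (q j.+1)) turnN // dotC.
  have -> : dot (q j.+1 - p i) (q j - p i) = dot (p i - q j.+1) (p i - q j).
    by rewrite /dot /=; ring.
  by apply: sep; rewrite ?leqnn ?leqnSn.
have cell i j : (i < n)%N -> (j < n)%N ->
  turn (p i - q j) (p i.+1 - q j) (+) turn (p i - q j.+1) (p i.+1 - q j.+1) =
  turn (p i - q j) (p i - q j.+1) (+) turn (p i.+1 - q j) (p i.+1 - q j.+1).
  move=> lt_in lt_jn; pose s := csqrt (p i - q j).
  have pos i' j' : (i <= i' <= i.+1)%N -> (j <= j' <= j.+1)%N ->
     0 < dot (p i' - q j') (csqr s).
    move=> hi hj; rewrite csqrtK; apply: sep => //.
      by case/andP: hi => _ /leq_trans; apply.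
    by case/andP: hj => _ /leq_trans; apply.
  rewrite !(@side_turn s) ?pos ?leqnn ?leqnSn //.
  move: (side s _) (side s _) (side s _) (side s _).
  by case; case; case; case.
have := grid_boundary cell.
rewrite -/(winding n p (q 0)) -/(winding n p (q n)) !V // => ->.
move: (flip _) (flip _) (flip _) (flip _) (winding _ _ _) (winding _ _ _).
by case; case; case; case; case; case.
Qed.

End SquareRoots.

(** * Sampling disjoint curves *)

Section FineSampling.
Variable R : realType.
Local Open Scope classical_set_scope.

Lemma within_continuous_eps (g : R -> R * R) (a eps : R) :
  {within `[0, 1], continuous g} -> 0 <= a <= 1 -> 0 < eps ->
  exists2 del : R, 0 < del & forall b, 0 <= b <= 1 -> `|b - a| < del ->
    `|(g b).1 - (g a).1| < eps /\ `|(g b).2 - (g a).2| < eps.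
Proof.
move=> /subspace_continuousP cg a01 eps0.
have /cg : `[0, 1]%classic a by rewrite /= in_itv.
move=> /(_ (ball (g a) eps)) [].
  exact: nbhsx_ballx.
move=> del /= del0 hdel; exists del => // b b01 bd.
have [] := hdel b _ _.
- by rewrite /= distrC.
- by rewrite /= in_itv.
by rewrite /ball /= => h1 h2; rewrite distrC; split; last rewrite distrC.
Qed.

(** With [M] the larger coordinate of [u] in absolute value, a perturbation by
    [M / 8] changes [dot u u], which is at least [M ^ 2], by less than [M ^ 2]. *)
Lemma dot_perturbation_gt0 (u v w : R * R) (M := Num.max `|u.1| `|u.2|) :
  0 < M ->
  `|v.1 - u.1| <= M / 8 -> `|v.2 - u.2| <= M / 8 ->
  `|w.1 - u.1| <= M / 8 -> `|w.2 - u.2| <= M / 8 ->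
  0 < dot v w.
Proof.
suff wlog_ (x y x1 y1 x2 y2 : R) : `|y| <= `|x| -> 0 < `|x| ->
  `|x1 - x| <= `|x| / 8 -> `|y1 - y| <= `|x| / 8 ->
  `|x2 - x| <= `|x| / 8 -> `|y2 - y| <= `|x| / 8 -> 0 < x1 * x2 + y1 * y2.
  rewrite /M /dot; case: (leP `|u.1| `|u.2|) => h M0 h1 h2 h3 h4.
    by rewrite addrC; apply: wlog_ h2 h1 h4 h3.
  by apply: wlog_ h1 h2 h3 h4 => //; apply: ltW.
have perturb (c d e m : R) : 0 < m -> `|d - c| <= m / 8 -> `|e - c| <= m / 8 ->
  c ^+ 2 - `|c| * m / 4 - m ^+ 2 / 64 <= d * e.
  move=> m0 hd he.
  have -> : d * e = c ^+ 2 + c * ((d - c) + (e - c)) + (d - c) * (e - c) by ring.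
  have h1 : `|c * ((d - c) + (e - c))| <= `|c| * (m / 4).
    rewrite normrM ler_wpM2l // (le_trans (ler_normD _ _)) //; lra.
  have h2 : `|(d - c) * (e - c)| <= m / 8 * (m / 8).
    by rewrite normrM ler_pM.
  move: h1 h2; rewrite !ler_norml => /andP[h1 _] /andP[h2 _]; nra.
move=> yx x0 hx1 hy1 hx2 hy2.
have := perturb _ _ _ _ x0 hx1 hx2; have := perturb _ _ _ _ x0 hy1 hy2.
rewrite -(real_normK (num_real x)) -(real_normK (num_real y)).
move: `|x| `|y| yx x0 (normr_ge0 y) => m c; nra.
Qed.

(** Near each point of the unit square, [g a - h b] stays within a small
    neighbourhood of a nonzero vector; compactness of the square makes the mesh
    uniform. *)
Lemma finely_separated_near (g h : R -> R * R) :
  {within `[0, 1], continuous g} -> {within `[0, 1], continuous h} ->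
  (forall a b : R, 0 <= a <= 1 -> 0 <= b <= 1 -> g a != h b) ->
  \forall n \near \oo, finely_separated n
     (fun i => g (i%:R / n%:R)) (fun j => h (j%:R / n%:R)).
Proof.
move=> cg ch gh.
pose K : set (R * R) := `[0, 1]%classic `*` `[0, 1]%classic.
have cK : compact K by apply: compact_setX; apply: segment_compact.
have {cK} := (compact_near_coveringP K).1 cK.
pose P (n : nat) (x : R * R) := K x -> forall y, K y -> `|y.1 - x.1| <= n%:R^-1 ->
  `|y.2 - x.2| <= n%:R^-1 -> 0 < dot (g y.1 - h y.2) (g x.1 - h x.2).
move=> /(_ nat \oo P _) nc.
have {nc}: \forall n \near \oo, K `<=` P n.
  apply: nc => -[a b] [/= a01 b01].
  rewrite !in_itv /= in a01 b01.
  set u := g a - h b.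
  have u0 : u != 0 by rewrite subr_eq0 gh.
  pose M := Num.max `|u.1| `|u.2|.
  have M0 : 0 < M.
    rewrite lt_max !normr_gt0 -negb_and; apply: contraNN u0.
    by case: (u) => ? ? /= /andP[/eqP -> /eqP ->].
  (* Each of the two endpoints of a difference moves by at most [M / 16], and
     [dot_perturbation_gt0] tolerates [M / 8]. *)
  have M16 : 0 < M / 16 by rewrite divr_gt0.
  have [d1 d10 hd1] := within_continuous_eps cg a01 M16.
  have [d2 d20 hd2] := within_continuous_eps ch b01 M16.
  pose d := Num.min d1 d2.
  have dd1 : d <= d1 by rewrite ge_min lexx.
  have dd2 : d <= d2 by rewrite ge_min lexx orbT.
  have d0 : 0 < d / 2 by rewrite divr_gt0 // lt_min d10.
  clearbody d.
  have hx : \forall x \near (a, b), ball (a, b) (d / 2) x by exact: nbhsx_ballx.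
  have hn : \forall n \near \oo, (n%:R^-1 : R) < d / 2.
    near=> n; have n0 : (d / 2)^-1 < n%:R by near: n; exact: nbhs_infty_gtr.
    rewrite -[d / 2]invrK ltf_pV2 ?posrE ?invr_gt0 //.
    by apply: lt_trans n0; rewrite invr_gt0.
  near=> x n => /= -[/= x1 x2] y [/= y1 y2] hy1 hy2.
  rewrite !in_itv /= in x1 x2 y1 y2.
  have [xa xb] : ball (a, b) (d / 2) x by near: x.
  have nd : (n%:R^-1 : R) < d / 2 by near: n.
  rewrite /ball /= in xa xb; rewrite distrC in xa; rewrite distrC in xb.
  have tri (s t r : R) : `|s - t| < d / 2 -> `|r - s| < d / 2 -> `|r - t| < d.
    by move=> h1 h2; rewrite -(subrKA s); apply: le_lt_trans (ler_normD _ _) _; lra.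
  have [] := hd1 x.1 x1 _; first by lra.
  have [] := hd1 y.1 y1 _; first by apply: lt_le_trans dd1; apply: tri xa _; lra.
  have [] := hd2 x.2 x2 _; first by lra.
  have [] := hd2 y.2 y2 _; first by apply: lt_le_trans dd2; apply: tri xb _; lra.
  have diff (s t s' t' : R) : `|s - s'| < M / 16 -> `|t - t'| < M / 16 ->
    `|(s - t) - (s' - t')| <= M / 8.
    move=> h1 h2; rewrite opprB [t' - s']addrC addrACA [- t + _]addrC.
    apply: le_trans (ler_normD _ _) _; rewrite [`|t' - t|]distrC; lra.
  move=> *; apply: (@dot_perturbation_gt0 u); rewrite -/M //; exact: diff.
case=> N _ hN; exists N.+1 => // n le_Nn i j i' j' hi hj lei lej.
have n0 : (0 < n)%N by apply: leq_trans le_Nn.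
have in01 k : (k <= n)%N -> 0 <= (k%:R / n%:R : R) <= 1.
  by move=> hk; rewrite divr_ge0 ?ler0n //= ler_pdivrMr ?ltr0n // mul1r ler_nat.
have step k k' : (k <= k' <= k.+1)%N -> `|k'%:R / n%:R - k%:R / n%:R| <= n%:R^-1 :> R.
  move=> /andP[h1 h2]; rewrite -mulrBl normrM -natrB // normr_nat normfV normr_nat.
  by rewrite ler_piMl ?invr_ge0 // -[leRHS]/(1%:R) ler_nat leq_subLR addn1.
have Kn k l : (k <= n)%N -> (l <= n)%N -> K (k%:R / n%:R, l%:R / n%:R).
  by move=> hk hl; split; rewrite /= in_itv /=; apply: in01.
have Kij : K (i%:R / n%:R, j%:R / n%:R).
  by apply: Kn; [case/andP: hi => /leq_trans-> | case/andP: hj => /leq_trans->].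
apply: (hN n (ltnW le_Nn) _ Kij Kij (i'%:R / n%:R, j'%:R / n%:R)).
- exact: Kn.
- exact: step.
- exact: step.
Unshelve. all: by end_near.
Qed.

End FineSampling.

(** * Winding parities in an embedded graph *)

Section Embedding.
Variables (R : realType) (G : bgraph) (emb : disc_embedding R G).
Variables (gt : rel G) (th : G -> R).
Hypothesis gt_asym : forall x y, x != y -> gt x y = ~~ gt y x.
Hypothesis th_pos : forall x, x \in boundary G ->
  pos emb x = circle_point (Defs.center emb) (Defs.radius emb) (th x).
Hypothesis th_gt : forall x y, x \in boundary G -> y \in boundary G ->
  x != y -> ~~ gt x y -> 0 < sin ((th y - th x) / 2).

Let pos := pos emb.
Let c := Defs.center emb.
Let r := Defs.radius emb.

Definition half_angle (x : G) : R * R := (cos (th x / 2), sin (th x / 2)).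

Lemma csqr_half_angle x : csqr (half_angle x) = (cos (th x), sin (th x)).
Proof.
rewrite /csqr /= [in RHS](splitr (th x)) cosD sinD -!expr2.
by congr pair; ring.
Qed.

Lemma dot_half_angle x : dot (half_angle x) (half_angle x) = 1.
Proof. by rewrite /dot -!expr2 cos2Dsin2. Qed.

Lemma boundary_pos x : x \in boundary G -> pos x = c + r *: csqr (half_angle x).
Proof. by move=> xb; rewrite /pos th_pos // csqr_half_angle. Qed.

(** A square root of the inward normal of the circle at the boundary vertex [x]. *)
Definition root_at (x : G) : R * R := quarter_turn (half_angle x).

(** The disc lies strictly on the inner side of its tangent at [w], except for [w]
    itself. *)
Lemma disc_halfplane (w : G) (p : R * R) :
  w \in boundary G -> closed_disc c r p -> p != pos w ->
  0 < dot (p - pos w) (csqr (root_at w)).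
Proof.
move=> wb pd pw; rewrite csqr_quarter_turn.
have r0 : 0 < r by apply: radius_gt0.
have uw : dot (csqr (half_angle w)) (csqr (half_angle w)) = 1.
  by rewrite csqr_half_angle /dot -!expr2 cos2Dsin2.
have := dot_gt0 (_ : p - pos w != 0); rewrite subr_eq0 => /(_ pw).
rewrite boundary_pos //; move: pd uw; rewrite /closed_disc /=.
move: (csqr _) (c) p {pw} => [x y] [c1 c2] [p1 p2]; rewrite /dot /= => pd uw.
set d1 := p1 - _ => h.
have : 0 < 2 * r * (r - ((p1 - c1) * x + (p2 - c2) * y)).
  suff : (p1 - (c1 + r * x)) * (p1 - (c1 + r * x)) + (p2 - (c2 + r * y)) *
   (p2 - (c2 + r * y)) <= 2 * r * (r - ((p1 - c1) * x + (p2 - c2) * y)).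
     by apply: lt_le_trans; exact: h.
  have -> : (p1 - (c1 + r * x)) * (p1 - (c1 + r * x)) + (p2 - (c2 + r * y)) *
   (p2 - (c2 + r * y)) = ((p1 - c1) ^+ 2 + (p2 - c2) ^+ 2) + r ^+ 2 * (x * x + y * y)
     - 2 * r * ((p1 - c1) * x + (p2 - c2) * y) by ring.
  rewrite uw; lra.
rewrite pmulr_rgt0 ?mulr_gt0 // => h2.
suff -> : d1 * - x + (p2 - (c2 + r * y)) * - y =
   r * (x * x + y * y)- ((p1 - c1) * x + (p2 - c2) * y) by rewrite uw mulr1.
by rewrite /d1 /GRing.scale /=; ring.
Qed.

(** The sign of the chosen root of [pos a - pos b] relative to [csqrt].  If [b] is
    a boundary vertex it is the canonical root on the half-plane at [b].
    Otherwise the choice for one order of [a] and [b] is free, and the choice for the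
    other order is what [branch_exchange] requires. *)
Definition branch (a b : G) : bool :=
  if b \in boundary G then side (root_at b) (pos a - pos b)
  else if a \in boundary G then
    side (root_at a) (pos b - pos a) (+) flip (pos b - pos a) (+) gt a b
  else gt a b && ~~ flip (pos b - pos a).

(** The roots chosen for [(a, b)] and [(b, a)] differ by [i] or [-i], according to
    the order of [a] and [b].  This is forced by geometry when both are boundary
    vertices, and holds by construction otherwise. *)
Lemma branch_exchange a b : a != b ->
  branch a b (+) branch b a (+) flip (pos b - pos a) = gt a b.
Proof.
have bd x y : x \in boundary G -> y \in boundary G -> x != y -> ~~ gt x y ->
  side (root_at y) (pos x - pos y) (+) side (root_at x) (pos y - pos x) =
  flip (pos y - pos x).
  move=> xb yb xy gxy; apply: (flip_circle_chord (radius_gt0 emb)).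
  - exact: dot_half_angle.
  - exact: dot_half_angle.
  - have := th_gt xb yb xy gxy; rewrite mulrBl sinB /dot /=.
    by congr (0 < _); ring.
  - rewrite !boundary_pos // scalerBr opprD addrACA subrr add0r.
    by [].
have flipC x y : x != y -> flip (pos y - pos x) = ~~ flip (pos x - pos y).
  move=> xy; rewrite -(opprB (pos x)) flipN // subr_eq0.
  by apply: contra xy => /eqP /pos_inj ->.
move=> ab; rewrite /branch; have ba : b != a by rewrite eq_sym.
have g2 := gt_asym ab.
have f2 := flipC _ _ ab.
case: ifPn => bb; case: ifPn => ab'.
- case gab : (gt a b); last by rewrite bd ?gab ?addbb.
  have : ~~ gt b a by rewrite -g2.
  move/(bd _ _ bb ab' ba); rewrite addbC => ->; rewrite f2.
  by case: (flip _).
- rewrite g2; move: (side _ _); rewrite f2; case: (flip _) (gt b a) => -[] [] //.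
- by move: (side _ _) (flip _) (gt a b) => -[] [] [].
- by rewrite g2 f2; case: (gt b a) (flip _) => -[].
Qed.

(** Vertex-disjoint edges have disjoint curves, so that all edges can be sampled
    with a common mesh that separates every such couple. *)
Lemma sampled_edges (x0 : G) :
  exists n (src tgt : {set G} -> G) (p : {set G} -> nat -> R * R),
    (forall e, e \in edges G ->
       [/\ src e != tgt e, e = [set src e; tgt e]%SET, p e 0 = pos (src e),
           p e n = pos (tgt e)
         & forall i, (i <= n)%N -> curve emb e (p e i)]) /\
    (forall e f, e \in edges G -> f \in edges G -> [disjoint e & f] ->
       finely_separated n (p e) (p f)).
Proof.
have /choice [D hD] : forall e : {set G}, exists d : (G * G) * (R -> R * R),
    e \in edges G -> [/\ adj d.1.1 d.1.2, e = [set d.1.1; d.1.2]%SET,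
      {within `[0, 1], continuous d.2}%classic, d.2 0 = pos d.1.1 /\ d.2 1 = pos d.1.2
      & forall t : R, 0 <= t <= 1 -> curve emb e (d.2 t)].
  move=> e; case: (boolP (e \in edges G)); last first.
    by move=> _; exists ((x0, x0), fun=> 0).
  move=> eE; have [x [y [xy e2]]] := edgesP _ eE.
  have [g [cg _ g0 g1 gC]] := curve_arc emb xy.
  exists ((x, y), g) => _; split => //= t t01.
  by rewrite e2 gC; exists t => //=; rewrite in_itv.
pose src e := (D e).1.1; pose tgt e := (D e).1.2; pose g e := (D e).2.
have adj_neq (x y : G) : adj x y -> x != y.
  by apply: contraTneq => ->; rewrite adj_irrefl.
(* The condition holds for all large [n], and there are finitely many couples. *)
have [n [n0 sep]] : exists n, (0 < n)%N /\ forall e f, e \in edges G ->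
    f \in edges G -> [disjoint e & f] ->
    finely_separated n (fun i => g e (i%:R / n%:R)) (fun i => g f (i%:R / n%:R)).
  pose sep n (ef : {set G} * {set G}) := ef.1 \in edges G ->
    ef.2 \in edges G -> [disjoint ef.1 & ef.2] ->
    finely_separated n (fun i => g ef.1 (i%:R / n%:R))
      (fun i => g ef.2 (i%:R / n%:R)).
  have : (\forall n \near \oo, forall ef, sep n ef)%classic.
    apply: filter_forall => -[e f] /=.
    case: (boolP [&& e \in edges G, f \in edges G & [disjoint e & f]]); last first.
      by move=> h; apply: filterE => n eE fE ef; rewrite eE fE ef in h.
    case/and3P=> eE fE ef.
    have [_ _ cge _ ce] := hD e eE; have [_ _ cgf _ cf] := hD f fE.
    have ncross (a b : R) : 0 <= a <= 1 -> 0 <= b <= 1 -> (D e).2 a != (D f).2 b.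
      move=> a01 b01; apply/negP => /eqP gg.
      have nef : e != f.
        have [x [y [_ e2]]] := edgesP _ eE; apply: contraTneq ef => <-.
        rewrite -setI_eq0 finset.setIid e2; apply/finset.set0Pn; exists x.
        by rewrite !inE eqxx.
      have [|x] := curve_cross eE fE nef (ce a a01).
        by rewrite gg; apply: cf.
      by rewrite finset.inE => /andP[xe xf]; rewrite (disjointFr ef xe) in xf.
    by apply: filterS (finely_separated_near cge cgf ncross) => n sepn _ _ _; exact: sepn.
  move=> h; have [N _ hN] := h; exists N.+1; split => // e f eE fE ef.
  exact: (hN N.+1 (leqnSn N) (e, f)).
exists n, src, tgt, (fun e i => g e (i%:R / n%:R)); split=> // e eE.
have [/adj_neq st e2 _ [g0 g1] ce] := hD e eE; split=> // [||i le_in].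
- by rewrite mul0r.
- by rewrite divff // pnatr_eq0 -lt0n.
by apply: ce; rewrite divr_ge0 ?ler0n //= ler_pdivrMr ?ltr0n // mul1r ler_nat.
Qed.

(** The parity [kappa e w] compares the roots chosen at the two ends of [e], as seen
    from [w], with their continuation along [e].  Seen from a boundary vertex, [e]
    stays in the half-plane of the canonical branch, where they agree. *)
Lemma exists_winding_parity : exists kappa : {set G} -> G -> bool,
  (forall e w, e \in edges G -> w \in boundary G -> w \notin e ->
     kappa e w = false) /\
  (forall e f, e \in edges G -> f \in edges G -> [disjoint e & f] ->
     \big[addb/false]_(a in e) \big[addb/false]_(b in f) gt a b =
     \big[addb/false]_(b in f) kappa e b (+) \big[addb/false]_(a in e) kappa f a).
Proof.
case: (pickP (predT : pred G)) => [x0 _|G0]; last first.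
  exists (fun _ _ => false); split => // e f /edgesP[x]; have := G0 x.
  by [].
have [n [src [tgt [p [edge_p sep]]]]] := sampled_edges x0.
have e2 e : e \in edges G -> e = [set src e; tgt e]%SET by case/edge_p.
have st e : e \in edges G -> src e != tgt e by case/edge_p.
have p0 e : e \in edges G -> p e 0 = pos (src e) by case/edge_p.
have pn e : e \in edges G -> p e n = pos (tgt e) by case/edge_p.
have sum2 e F : e \in edges G ->
    \big[addb/false]_(a in e) F a = F (src e) (+) F (tgt e).
  by move=> eE; rewrite {1}(e2 e eE) big_addb_set2 ?st.
exists (fun e w => winding n (p e) (pos w) (+) \big[addb/false]_(a in e) branch a w).
split.
  move=> e w eE wb we; rewrite sum2 //.
  rewrite -[RHS](addbb (branch (src e) w (+) branch (tgt e) w)); congr (_ (+) _).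
  rewrite /branch wb -p0 // -pn // -(telescope_addb n (fun i => side _ (p e i - _))).
  have half i : (i <= n)%N -> 0 < dot (p e i - pos w) (csqr (root_at w)).
    move=> le_in; have [_ _ _ _ /(_ i le_in) ce] := edge_p e eE.
    apply: disc_halfplane => //; first exact: curve_disc eE _ ce.
    by apply: contraNneq we => pw; move: ce; rewrite pw; apply: curve_vertex.
  by apply: eq_bigr => i _; apply: side_turn; apply: half; rewrite // ltnW.
move=> e f eE fE ef.
have ne a b : a \in e -> b \in f -> a != b.
  by move=> ae bf; apply: contraTneq ae => ->; rewrite (disjointFl ef).
(* The sign around the square: the two sides along [e] and the two along [f]. *)
have wf : \big[addb/false]_(b in f) winding n (p e) (pos b) (+)
    \big[addb/false]_(a in e) winding n (p f) (pos a) =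
    \big[addb/false]_(a in e) \big[addb/false]_(b in f) flip (pos b - pos a).
  by rewrite !sum2 // -!p0 // -!pn // winding_exchange //; apply: sep.
(* What remains is [branch_exchange] summed over [e] and [f]. *)
rewrite !big_split addbACA wf addbC -addbA.
rewrite [X in X (+) (_ (+) _)]exchange_big -!big_split /=.
apply: eq_bigr => a ae; rewrite -!big_split; apply: eq_bigr => b bf /=.
by rewrite -branch_exchange ?ne // addbA.
Qed.
End Embedding.

(** * Boundary angles *)

Section Angles.
Variable R : realType.

(** Rotating the list moves the first [k] points behind the others; adding a full
    turn to their angles keeps the angles increasing within one turn. *)
Lemma rotate_angles (T : eqType) (s : seq T) (phi : T -> R) k : uniq s ->
  sorted (fun x y => phi x < phi y) s ->
  {in s &, forall x y, phi y < phi x + 2 * pi} ->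
  exists2 th : T -> R,
    forall x, cos (th x) = cos (phi x) /\ sin (th x) = sin (phi x) &
    pairwise (fun x y => 0 < th y - th x < 2 * pi) (rot k s).
Proof.
move=> us; rewrite sorted_pairwise; last by move=> ? ? ?; apply: lt_trans.
move=> ps turn2.
pose th x := phi x + (if x \in take k s then pi *+ 2 else 0).
exists th => [x|].
  by rewrite /th; case: ifP; rewrite ?addr0 // cosD2pi sinD2pi.
have th_take x : x \in take k s -> th x = phi x + 2 * pi.
  by move=> xt; rewrite /th xt mulr_natl.
move: (us); rewrite -{1}(cat_take_drop k s) cat_uniq => /and3P[_ /hasPn ndt _].
have th_drop x : x \in drop k s -> th x = phi x.
  by move=> xd; rewrite /th (negbTE (ndt x xd)) addr0.
move: ps; rewrite -{1}(cat_take_drop k s) pairwise_cat => /and3P[/allrelP tds pt pd].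
rewrite /rot pairwise_cat; apply/and3P; split.
- apply/allrelP => x y xd yt; rewrite th_take // th_drop //.
  have := tds _ _ yt xd; have := turn2 y x (mem_take yt) (mem_drop xd).
  by lra.
- apply: (sub_in_pairwise (P := mem (drop k s))) pd; last exact/allP.
  move=> x y xd yd; rewrite !th_drop //.
  by have := turn2 x y (mem_drop xd) (mem_drop yd) => ? ?; lra.
apply: (sub_in_pairwise (P := mem (take k s))) pt; last exact/allP.
move=> x y xd yd; rewrite !th_take //.
by have := turn2 x y (mem_take xd) (mem_take yd) => ? ?; lra.
Qed.
End Angles.

Section VertexOrder.
Variables (R : realType) (N n : nat) (G : bgraph) (emb : disc_embedding R G).
Variables (v : 'I_(N + n) -> G) (w : G -> 'I_(N + n)).
Hypotheses (vK : cancel v w) (wK : cancel w v).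
Hypothesis v_boundary : exists k,
     [seq v (rshift N j) | j <- enum 'I_n] = rot k (boundary_seq G).

Lemma boundary_index x : (x \in boundary G) = (N <= w x)%N.
Proof.
have [k bE] := v_boundary.
rewrite inE -(mem_rot k) -bE; apply/mapP/idP => [[j _ ->]|le_N].
  by rewrite vK /= leq_addr.
have lt_n : (w x - N < n)%N by rewrite ltn_subLR.
exists (Ordinal lt_n); rewrite ?mem_enum //; apply: (can_inj wK).
by rewrite vK; apply: val_inj; rewrite /= subnKC.
Qed.

Lemma pairwise_boundary (rT : rel G) x y :
  pairwise rT [seq v (rshift N j) | j <- enum 'I_n] ->
  x \in boundary G -> y \in boundary G -> (w x < w y)%N -> rT x y.
Proof.
move=> /(pairwiseP x) pw; rewrite !boundary_index => xb yb xy.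
have lt_n z : (N <= w z)%N -> (w z - N < n)%N by move=> zb; rewrite ltn_subLR.
have nthE z : (N <= w z)%N ->
    nth x [seq v (rshift N j) | j <- enum 'I_n] (w z - N) = z.
  move=> zb; rewrite (nth_map (Ordinal (lt_n z zb))) ?size_enum_ord ?lt_n //.
  rewrite -[LHS]wK -[RHS]wK; congr v; rewrite vK; apply: val_inj => /=.
  by rewrite nth_enum_ord ?lt_n // subnKC.
rewrite -(nthE x) // -(nthE y) //; apply: pw.
- by rewrite unfold_in /= size_map size_enum_ord lt_n.
- by rewrite unfold_in /= size_map size_enum_ord lt_n.
by rewrite ltn_sub2r // (leq_ltn_trans xb).
Qed.

(** A decreasing family of angles becomes increasing after a change of sign; [b]
    records whether this was done. *)
Lemma boundary_angles : exists (th : G -> R) (b : bool),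
  (forall x, x \in boundary G ->
    pos emb x = circle_point (Defs.center emb) (Defs.radius emb) (th x)) /\
  (forall x y, x \in boundary G -> y \in boundary G -> x != y ->
    ~~ ((w y < w x)%N (+) b) -> 0 < sin ((th y - th x) / 2)).
Proof.
have [k bE] := v_boundary; pose ang := Defs.angle emb.
have bnd : {in boundary_seq G, forall x, x \in boundary G} by move=> x; rewrite inE.
have sin_pos (a : R) : 0 < a < 2 * pi -> 0 < sin (a / 2).
  by move=> /andP[a0 a1]; apply: sin_gt0_pi; rewrite divr_gt0 //= ltr_pdivrMr // mulrC.
have [inc|dec] := Defs.angle_sorted emb.
  have [|th thE th_pw] := rotate_angles k (boundary_seq_uniq G) inc.
    by move=> x y /bnd xb /bnd yb; apply: Defs.angle_turn.
  exists th, false; split => [x xb|x y xb yb xy].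
    by rewrite (Defs.pos_boundary emb xb) /circle_point; have [-> ->] := thE x.
  rewrite addbF -leqNgt leq_eqVlt (inj_eq val_inj) (inj_eq (can_inj wK)) (negbTE xy) /=.
  move=> xy_lt; apply: sin_pos.
  by apply: (pairwise_boundary (rT := fun x y => 0 < th y - th x < 2 * pi)) xb yb xy_lt;
    rewrite bE.
have [||th thE th_pw] := @rotate_angles _ _ _ (fun x => - ang x) k (boundary_seq_uniq G).
- by apply: sub_sorted dec => x y /=; rewrite ltrN2.
- move=> x y /bnd xb /bnd yb.
  by have := Defs.angle_turn emb yb xb; rewrite -/ang; lra.
exists (fun x => - th x), true; split => [x xb|x y xb yb xy].
  rewrite (Defs.pos_boundary emb xb) /circle_point cosN sinN.
  by have [-> ->] := thE x; rewrite cosN sinN opprK.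
rewrite addbT negbK => xy_lt; apply: sin_pos; rewrite opprK addrC.
by apply: (pairwise_boundary (rT := fun x y => 0 < th y - th x < 2 * pi)) yb xb xy_lt;
  rewrite bE.
Qed.

Lemma order_winding_parity : exists kappa : {set G} -> G -> bool,
  (forall e x, e \in edges G -> x \in boundary G -> x \notin e ->
     kappa e x = false) /\
  (forall e f, e \in edges G -> f \in edges G -> [disjoint e & f] ->
     \big[addb/false]_(a in e) \big[addb/false]_(b in f) (w b < w a)%N =
     \big[addb/false]_(b in f) kappa e b (+) \big[addb/false]_(a in e) kappa f a).
Proof.
have [th [b [th_pos th_gt]]] := boundary_angles.
have gt_asym x y : x != y -> (w y < w x)%N (+) b = ~~ ((w x < w y)%N (+) b).
  move=> xy; rewrite -addNb -leqNgt [in RHS]leq_eqVlt (inj_eq val_inj) (inj_eq (can_inj wK)).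
  by rewrite eq_sym (negbTE xy).
(* The parity is obtained for the order or for its reverse, according to the
   sense of rotation. *)
have [kappa [k_bnd k_exch]] :=
  exists_winding_parity (gt := fun x y => (w y < w x)%N (+) b) gt_asym th_pos th_gt.
exists kappa; split=> // e f eE fE ef; rewrite -k_exch //.
(* An edge has two ends, so that a constant cancels. *)
have sum2 F g : g \in edges G -> \big[addb/false]_(a in g) (F a (+) b) =
    \big[addb/false]_(a in g) F a.
  by move=> /edge_card gE; rewrite big_split big_const gE /= addbF addbb addbF.
rewrite exchange_big [RHS]exchange_big; apply: eq_bigr => y _.
by rewrite sum2.
Qed.

End VertexOrder.

Theorem theorem5 (R : realType) (N n : nat) (G : bgraph)
  (emb : disc_embedding R G)
  (v : 'I_(N + n) -> G) (v_bij : bijective v)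
  (v_boundary : exists k,
     [seq v (rshift N j) | j <- enum 'I_n] = rot k (boundary_seq G)) :
  exists X : 'M[int]_(N + n),
    [/\ forall i j, X i j = - X j i,
        forall i j, adj (v i) (v j) -> X i j = 1 \/ X i j = -1,
        forall i j, ~~ adj (v i) (v j) -> X i j = 0
      & forall I : {set G}, I \subset boundary G ->
          (num_matchings I)%:Z =
          Pf (principal_submx X [set i : 'I_(N + n) | (i < N)%N || (v i \in I)])].
Proof.
have [w vK wK] := v_bij.
have [kappa [k_bnd k_exch]] := order_winding_parity emb vK wK v_boundary.
(* Only internal vertices enter [tau], so that it does not depend on [I]. *)
pose tau (e : {set G}) :=
  \big[addb/false]_(x in (~: boundary G)%SET | x \notin e) kappa e x.
pose X : 'M[int]_(N + n) := \matrix_(i, j)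
  if adj (v i) (v j) then (-1) ^+ ((j < i)%N (+) tau [set v i; v j]%SET) else 0.
exists X; split=> [i j|i j ij|i j /negbTE ij|I IsubB]; rewrite ?mxE ?ij //.
- rewrite adj_sym finset.setUC; case: ifP => ij; last by rewrite oppr0.
  case: (ltngtP i j) => [||/val_inj e]; last by rewrite e adj_irrefl in ij.
    by rewrite addFb addTb; case: (tau _).
  by rewrite addFb addTb; case: (tau _).
- by case: (_ (+) _); [right|left].
rewrite num_matchingsE //.
set J := [set i : 'I_(N + n) | (i < N)%N || (v i \in I)]%SET.
pose f (i : 'I_#|J|) := v (enum_val i).
have f_inj : injective f by move=> i j /(can_inj vK)/enum_val_inj.
have codom_f : (f @: [set: 'I_#|J|])%SET = (~: boundary G :|: I)%SET.
  apply/finset.setP => x; rewrite finset.in_setU finset.in_setC.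
  rewrite (boundary_index vK wK v_boundary).
  rewrite -ltnNge -[x in x \in I]wK; transitivity (w x \in J); last by rewrite !inE.
  apply/imsetP/idP => [[i _ ->]|xJ]; first by rewrite vK enum_valP.
  by exists (enum_rank_in xJ (w x)); rewrite // /f enum_rankK_in.
rewrite -codom_f; apply/esym.
apply: (Pf_counts_matchings (gt := fun x y => (w y < w x)%N) (kappa := kappa)) => //.
- exact: edge_card.
- by move=> i j; rewrite !vK enum_val_mono.
move=> i j /=; rewrite edge_adj !mxE; case: ifP => // ij; rewrite enum_val_mono.
congr (_ ^+ (_ (+) _)); rewrite codom_f /tau -/(f i) -/(f j).
have eE : [set f i; f j]%SET \in edges G by rewrite edge_adj.
rewrite big_mkcond [RHS]big_mkcond; apply: eq_bigr => x _.
rewrite [x \in _ :|: I]finset.in_setU finset.in_setC.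
have [xb|//] := boolP (x \in boundary G).
by rewrite /=; case: ifP => // /andP[_ xe]; rewrite k_bnd.
Qed.
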